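(* Let $F$ be an algebraically closed field and let $k$ be a field of transcendence degree one over $F$, equipped with an involution $\lambda\mapsto\bar\lambda$ which is the identity on $F$; assume that the involution is not the identity on $k$, or else that $\operatorname{char} k\neq 2$. Let $(\ ,\ ):V\times V\to k$ be a hermitian form on a finite-dimensional $k$-vector space $V$ with a trivial action of a finite group $G$. Then $W\subset W^{\perp}$, where $W$ denotes the ($G$-invariant) subspace generated by a non-zero isotropic element of $V$. So in case $\dim V\ge 3$ and the involution is the identity on $F$ (a condition very natural if $k$ is considered as a field of rational functions on a non-singular curve over $F$), the proof of Maschke's Theorem used in the case of the real or complex field cannot be generalized.
   Context: An involution of a field $k$ is a field automorphism $\lambda\mapsto\bar\lambda$ of order $\le 2$ (the identity is allowed). A map $(\ ,\ ):V\times V\to k$ is a hermitian form if it is linear in the first variable and $\overline{(v,w)}=(w,v)$ for all $v,w\in V$ (no nondegeneracy or positivity is required). An element $v\in V$ is isotropic if $(v,v)=0$. For a subspace $W\subset V$, $W^\perp=\{v\in V\mid (v,w)=0 \text{ for all } w\in W\}$ is its orthogonal complement. Maschke's Theorem says that a finite-dimensional representation $V$ over $k$ of a finite group $G$ is completely reducible if $\operatorname{char} k$ does not divide the order of $G$. The proof in the real or complex case referred to here is: $V$ admits a $G$-invariant positive definite hermitian form; its restriction to any $G$-invariant subspace $W$ is nondegenerate, so $V=W\oplus W^\perp$, and $W^\perp$ is $G$-invariant. Generalizing it would mean finding on every finite-dimensional $G$-module $V$ over $k$ (with $\operatorname{char} k$ not dividing the order of $G$) a $G$-invariant hermitian form whose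 restriction to every (proper) $G$-invariant submodule is nondegenerate. *)

(* Defs.v *)
From HB Require Import structures.
From mathcomp Require Import all_boot all_order all_fingroup all_algebra.

Set Implicit Arguments.
Unset Strict Implicit.
Unset Printing Implicit Defensive.

Import GRing.Theory.
Local Open Scope ring_scope.

(* An extension k / F is given by a ring morphism iota : F -> k, which is
   automatically injective. *)

(* x lies in the subfield F(t) of k.  As 0^-1 = 0, a quotient p(t) / q(t) with
   q(t) = 0 denotes 0, so no side condition on q is needed. *)
Definition in_simple_ext (F k : fieldType) (iota : {rmorphism F -> k})
    (t x : k) : Prop :=
  exists p q : {poly F}, x = (map_poly iota p).[t] / (map_poly iota q).[t].

Definition algebraic_over_simple_ext (F k : fieldType)
    (iota : {rmorphism F -> k}) (t x : k) : Prop :=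
  exists p : {poly k},
    [/\ p != 0, forall i, in_simple_ext iota t p`_i & root p x].

(* {t} is a transcendence basis of k / F for some t. *)
Definition trdeg_one (F k : fieldType) (iota : {rmorphism F -> k}) : Prop :=
  exists t : k, ~ algebraicOver iota t /\
    forall x : k, algebraic_over_simple_ext iota t x.

Section Modules.
Variables (k : fieldType) (gT : finGroupType) (V : vectType k).
Variable to : {action gT &-> V}.

(* MathComp actions are right actions; left modules correspond to them through
   inversion in the group, with the same submodules. *)
Definition linear_action : Prop := forall g : gT, linear (to^~ g).

Definition trivial_action : Prop := forall (v : V) (g : gT), to v g = v.

Definition submodule (W : {vspace V}) : Prop :=
  forall (w : V) (g : gT), w \in W -> to w g \in W.

Variable sigma : {rmorphism k -> k}.
Variable form : {hermitian_sym V for sigma}.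

Definition isotropic (v : V) : Prop := form v v = 0.

Definition invariant_form : Prop :=
  forall (g : gT) (u v : V), form (to u g) (to v g) = form u v.

(* The radical of the restriction of the form to W is the intersection of W
   with its orthogonal. *)
Definition nondegenerate_on (W : {vspace V}) : Prop :=
  (W :&: orthov form W = 0)%VS.

Definition Maschke_form : Prop :=
  invariant_form /\
  forall W : {vspace V}, submodule W -> W <> fullv -> nondegenerate_on W.

End Modules.

(* The form needed to carry over the classical proof of Maschke's theorem
   exists on every finite-dimensional module of the group gT over k. *)
Definition Maschke_proof_generalizes (k : fieldType)
    (sigma : {rmorphism k -> k}) (gT : finGroupType) : Prop :=
  forall (V : vectType k) (to : {action gT &-> V}), linear_action to ->
    exists form : {hermitian_sym V for sigma}, Maschke_form to form.

(* Main.v *)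
(** The point is that every hermitian (even sesquilinear) form in three variables
   over k has a nontrivial zero; the line through it is then a totally isotropic
   proper submodule.

   Let X be a finite subset of k stable under the involution and containing the
   coefficients of the form, and let V_m be the F-span of the products of m
   elements of X.  Since k is algebraic over some F(t), dim V_m <= C (m + 1).
   On triples of elements of V_m the form is given by dim V_(2m+1) quadratic
   forms over F in 3 dim V_m variables, because the involution is F-linear.
   Over an algebraically closed field, fewer quadratic forms than variables have
   a common nontrivial zero, so an anisotropic form satisfies
   3 dim V_m <= dim V_(2m+1), hence dim V_(2^j - 1) >= 3^j, which contradicts
   the linear bound.

   For the statement on quadratic forms: if there is no zero, the weak
   Nullstellensatz in the charts x_i = 1 puts a power of every variable in the
   ideal of the forms f_j, so all polynomials of degree <= D are combinations of
   O(D^M) products f^a x^m with m bounded, whereas they form a space of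
   dimension of order D^N with N > M. *)

Require Import Defs.
From Stdlib Require Import Classical.
From HB Require Import structures.
From mathcomp Require Import all_boot all_order all_fingroup all_algebra.
From mathcomp Require Import mpoly zify ring.

Set Implicit Arguments.
Unset Strict Implicit.
Unset Printing Implicit Defensive.

Import GRing.Theory.
Local Open Scope ring_scope.

(** Classical well-ordering, for predicates that are not decidable, such as the existence of an
    ideal element of a given degree. *)
Lemma ex_least_nat (P : nat -> Prop) :
  (exists n, P n) -> exists2 n, P n & forall m, P m -> (n <= m)%N.
Proof.
case=> n; elim/ltn_ind: n => n IHn Pn.
have [[m [lt_mn Pm]]|noP] := classic (exists m, (m < n)%N /\ P m).
  exact: IHn lt_mn Pm.
by exists n => // m Pm; rewrite leqNgt; apply/negP => lt_mn; apply: noP; exists m.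
Qed.

(** * Weak Nullstellensatz *)

Section ExtendPoint.
Variables (F : closedFieldType) (A B : comNzRingType).
Variables (c : {rmorphism F -> A}) (ev : {rmorphism A -> B}).
Variables (phi : {rmorphism A -> F}) (phic : forall x, phi (c x) = x).
Variable I : B -> Prop.
Hypothesis I_add : forall u v, I u -> I v -> I (u + v).
Hypothesis I_mul : forall a u, I u -> I (a * u).
Hypothesis I_proper : ~ I 1.
Variables (y : B) (g : {poly A}) (g_monic : g \is monic).
Hypothesis I_g : I (map_poly ev g).[y].
Hypothesis phi_I : forall a, I (ev a) -> phi a = 0.

Lemma closed_sum (T : Type) (r : seq T) (E : T -> B) :
  I 0 -> (forall t, I (E t)) -> I (\sum_(t <- r) E t).
Proof. by move=> I0 IE; elim/big_ind: _. Qed.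

(* If f specialises to 1, the matrix M of multiplication by f modulo g
   specialises to the identity, whereas Cramer's rule puts det M in I. *)
Lemma specialization_neq1 (f : {poly A}) :
  I (map_poly ev f).[y] -> map_poly phi f <> 1.
Proof.
move=> If f1.
have I0 : I 0 by rewrite -(mul0r (map_poly ev f).[y]); exact: I_mul.
have IN u : I u -> I (- u) by rewrite -mulN1r; exact: I_mul.
pose r i := Pdiv.CommonRing.rmodp ('X^i * f) g.
pose q i := Pdiv.CommonRing.rdivp ('X^i * f) g.
have rE i : r i = 'X^i * f - q i * g.
  by rewrite {1}(Pdiv.RingMonic.rdivp_eq g_monic ('X^i * f)) addrC addKr.
have gN0 : g != 0 by apply: monic_neq0.
have size_r i : (size (r i) < size g)%N.
  by apply: Pdiv.CommonRing.ltn_rmodpN0.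
pose d := (size g).-1.
have dS : size g = d.+1 by rewrite /d prednK // size_poly_gt0.
have I_r i : I (map_poly ev (r i)).[y].
  rewrite rE rmorphB !rmorphM !hornerE; apply: I_add; first exact: I_mul.
  by apply: IN; apply: I_mul.
pose M : 'M[A]_d := \matrix_(i, j) (r i)`_j.
have I_row (i : 'I_d) : I (\sum_(j < d) ev (M i j) * y ^+ j).
  suff <- : (map_poly ev (r i)).[y] = \sum_(j < d) ev (M i j) * y ^+ j by [].
  rewrite (@horner_coef_wide _ d).
    by apply: eq_bigr => j _; rewrite coef_map mxE.
  by apply: leq_trans (size_poly _ _) _; rewrite -ltnS -dS.
have phiM : map_mx phi M = 1%:M.
  apply/matrixP => i j; rewrite !mxE.
  have -> : phi (r i)`_j = (map_poly phi (r i))`_j by rewrite coef_map.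
  suff -> : map_poly phi (r i) = 'X^i by rewrite coefXn eq_sym.
  have gS : size (map_poly phi g) = d.+1.
    by rewrite size_map_poly_id0 // (monicP g_monic) rmorph1 oner_neq0.
  (* Since [f] specialises to 1, both [phi (r i)] and ['X^i] are remainders of ['X^i] modulo the
     specialised [g]; division over [F] has a unique remainder. *)
  have := congr1 (map_poly phi) (rE i).
  rewrite rmorphB !rmorphM /= f1 mulr1 map_polyXn => rE'.
  have size_phi_r : (size (map_poly phi (r i)) < size (map_poly phi g))%N.
    by rewrite gS -dS; apply: leq_ltn_trans (size_poly _ _) _.
  have := modp_addl_mul_small (map_poly phi (q i)) size_phi_r.
  rewrite {1}rE' addrC subrK => <-.
  by rewrite modp_small // gS size_polyXn ltnS.
have I_det : I (ev (\det M)).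
  have [d0|d_gt0] := posnP d.
    have g1 : g = 1.
      by have := size1_polyC (eq_leq (etrans dS (congr1 S d0))) => ge;
         move: (g_monic); rewrite ge monicE lead_coefC => /eqP ->.
    by case: I_proper; move: I_g; rewrite g1 rmorph1 hornerC.
  (* The entry of index 0 of [w] is [y ^+ 0 = 1], so the same entry of [adj M * M * w] is [det M];
     the entries of [M * w] lie in [I] by [I_row]. *)
  pose w : 'cV[B]_d := \col_j y ^+ j.
  have := congr1 (fun X : 'M_d => (X *m w) (Ordinal d_gt0) 0)
            (mul_adj_mx (map_mx ev M)).
  rewrite mul_scalar_mx -mulmxA !mxE expr0 mulr1 det_map_mx => <-.
  apply: closed_sum => // j; apply: I_mul; rewrite mxE.
  suff -> : \sum_j0 (map_mx ev M) j j0 * w j0 0 = \sum_(j0 < d) ev (M j j0) * y ^+ j0 by [].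
  by apply: eq_bigr => l _; rewrite !mxE.
have /eqP := phi_I I_det.
by rewrite -det_map_mx phiM det1 oner_eq0.
Qed.

(** The specialisations of the [f] with [f(y)] in [I] form an ideal of [F[Y]], because [c] lifts
    scalars back to [A]. This ideal is proper by [specialization_neq1]. If it is nonzero, an element
    of least degree divides all others, and any root of it serves as [y0]. *)
Lemma extend_point :
  exists y0, forall f, I (map_poly ev f).[y] -> (map_poly phi f).[y0] = 0.
Proof.
have [[f [If fN0]]|allf0] :=
  classic (exists f, I (map_poly ev f).[y] /\ map_poly phi f != 0); last first.
  exists 0 => f If; suff -> : map_poly phi f = 0 by rewrite horner0.
  by apply/eqP/negPn/negP => fN0; apply: allf0; exists f.
have [|n [{If fN0}f [If fN0 fn]] n_min] := ex_least_nat (P := fun n =>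
    exists f, [/\ I (map_poly ev f).[y], map_poly phi f != 0
                & size (map_poly phi f) = n]).
  by exists (size (map_poly phi f)), f.
have lift_poly h : map_poly phi (map_poly c h) = h.
  by rewrite -map_poly_comp map_poly_id // => x _ /=.
have If_mul h f' : I (map_poly ev f').[y] -> I (map_poly ev (h * f')).[y].
  by rewrite rmorphM hornerM; exact: I_mul.
have /closed_rootP [y0 y0P] : size (map_poly phi f) != 1%N.
  (* A nonzero constant could be scaled to 1 by the lift of its inverse, which [specialization_neq1]
     forbids. *)
  apply/negP => /eqP/eq_leq/size1_polyC fC.
  have f0N0 : (map_poly phi f)`_0 != 0 by rewrite -polyC_eq0 -fC.
  apply: (@specialization_neq1 (map_poly c ((map_poly phi f)`_0)^-1%:P * f)).
    exact: If_mul.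
  by rewrite rmorphM /= lift_poly {2}fC -polyCM mulVf.
exists y0 => f' If'; apply/rootP; apply: root_dvdp y0P.
rewrite /dvdp; apply/negPn/negP => mN0.
pose f'' := f' - map_poly c (map_poly phi f' %/ map_poly phi f) * f.
have f''E : map_poly phi f'' = map_poly phi f' %% map_poly phi f.
  rewrite rmorphB rmorphM /= lift_poly.
  by rewrite {1}(divp_eq (map_poly phi f') (map_poly phi f)) addrC addKr.
have := n_min (size (map_poly phi f'')); rewrite f''E leqNgt -fn ltn_modp fN0.
move/(_ _)/negP => H; suff : False by [].
apply: H => //; exists f''; rewrite f''E; split=> //.
rewrite /f'' rmorphB hornerD hornerN; apply: I_add => //.
rewrite -mulN1r; apply: I_mul; exact: If_mul.
Qed.

End ExtendPoint.

Lemma rmorph_mmap n (R : nzRingType) (S T : comNzRingType)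
    (f : {rmorphism R -> S}) (h : 'I_n -> S) (psi : {rmorphism S -> T}) p :
  psi (mmap f h p) = mmap (psi \o f) (psi \o h) p.
Proof.
rewrite /mmap rmorph_sum; apply: eq_bigr => m _.
rewrite rmorphM rmorph_prod; congr (_ * _); apply: eq_bigr => i _.
by rewrite rmorphXn.
Qed.

(** Remainder and quotient by [D] recover the lowest digit and the number formed by the others. *)
Lemma base_expansion_inj n (D : nat) (a b : 'I_n -> nat) :
  (forall i, (a i < D)%N) -> (forall i, (b i < D)%N) ->
  (\sum_(i < n) a i * D ^ i = \sum_(i < n) b i * D ^ i)%N -> a =1 b.
Proof.
elim: n a b => [|n IHn] a b aD bD; first by move=> _ [].
have D_gt0 : (0 < D)%N by apply: leq_trans (aD ord0).
have shift (u : 'I_n.+1 -> nat) : (\sum_(i < n.+1) u i * D ^ i =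
    (\sum_(i < n) u (lift ord0 i) * D ^ i) * D + u ord0)%N.
  rewrite big_ord_recl expn0 muln1 addnC big_distrl /=; congr (_ + _)%N.
  by apply: eq_bigr => i _; rewrite /bump /= add1n expnSr mulnA.
rewrite !shift => eq_ab.
have eq0 : a ord0 = b ord0.
  by have := congr1 (modn^~ D) eq_ab; rewrite !modnMDl !modn_small.
have eqS : (\sum_(i < n) a (lift ord0 i) * D ^ i =
            \sum_(i < n) b (lift ord0 i) * D ^ i)%N.
  have := congr1 (divn^~ D) eq_ab.
  by rewrite !divnMDl // !divn_small // !addn0.
have eq_lift := IHn (fun j => a (lift ord0 j)) (fun j => b (lift ord0 j))
                  (fun j => aD _) (fun j => bD _) eqS.
by move=> i; case: (unliftP ord0 i) => [j ->|->] //; exact: eq_lift.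
Qed.

(* Nagata's change of variables x_(i+1) -> x_i + Y^(D^(i+1)), x_0 -> Y. *)
Section Nagata.
Variables (F : fieldType) (n D : nat).
Let A : comNzRingType := {mpoly F[n]}.

Definition nagata_var (i : 'I_n.+1) : {poly A} :=
  if unlift ord0 i is Some j then ('X_j)%:P + 'X^(D ^ j.+1) else 'X.

Definition nagata_scalar : {rmorphism F -> {poly A}} := polyC \o @mpolyC n F.

Definition nagata (f : {mpoly F[n.+1]}) : {poly A} :=
  mmap nagata_scalar nagata_var f.

(** The degree in [Y] of the image of the monomial [m]. When all exponents are below [D] they are
    the base [D] digits of the weight. *)
Definition weight (m : 'X_{1..n.+1})  : nat := (\sum_(i < n.+1) m i * D ^ i)%N.

Lemma nagata_var_monic i : (0 < D)%N ->
  (nagata_var i \is monic) /\ size (nagata_var i) = (D ^ i).+1.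
Proof.
move=> D_gt0; rewrite /nagata_var; case: unliftP => [j ->|->]; last first.
  by rewrite monicX size_polyX.
have lt_size : (size (('X_j)%:P : {poly A}) < size ('X^(D ^ j.+1) : {poly A}))%N.
  rewrite size_polyXn ltnS; apply: leq_trans (size_polyC_leq1 _) _.
  by rewrite expn_gt0 D_gt0.
split; last by rewrite addrC size_polyDl // size_polyXn.
by rewrite monicE addrC lead_coefDl // lead_coefXn.
Qed.

Lemma size_monic_exp (p : {poly A}) e k : p \is monic -> size p = e.+1 ->
  size (p ^+ k) = (k * e).+1.
Proof.
move=> p_monic size_p; elim: k => [|k IHk]; first by rewrite size_poly1.
by rewrite exprS size_monicM ?monic_neq0 ?monic_exp // IHk size_p addSn addnS.
Qed.

Lemma nagata_monomial m : (0 < D)%N ->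
  (mmap1 nagata_var m \is monic) /\ size (mmap1 nagata_var m) = (weight m).+1.
Proof.
move=> D_gt0; rewrite /mmap1 /weight.
elim/big_rec2: _ => [|i w p _ [p_monic size_p]].
  by rewrite monic1 size_poly1.
have [v_monic size_v] := nagata_var_monic i D_gt0.
split; first by rewrite monicMl // monic_exp.
rewrite size_monicM ?monic_exp ?monic_neq0 // size_p addnS /=.
by rewrite (size_monic_exp _ v_monic size_v) addSn.
Qed.

(** Distinct monomials of [f] have distinct weights, so a single one produces the top power of [Y].
    The leading coefficient of [nagata f] is then a nonzero scalar, and dividing by it gives [g]. *)
Lemma nagata_regular f : f != 0 -> (forall m i, m \in msupp f -> (m i < D)%N) ->
  exists2 g : {poly A}, g \is monic & exists h, g = h * nagata f.
Proof.
move=> fN0 ltD.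
have D_gt0 : (0 < D)%N.
  by have /ltD := mlead_supp fN0; move/(_ ord0); apply: leq_trans.
have [m0 m0f m0_max] : exists2 m0, m0 \in msupp f &
    forall m, m \in msupp f -> (weight m <= weight m0)%N.
  have : mlead f \in msupp f := mlead_supp fN0.
  move: (mlead f) => {}m0; elim: (msupp f) m0 => // m s IHs _ _.
  case: s IHs => [_|m' s' IHs]; first by exists m => [|m1]; rewrite inE // => /eqP ->.
  have [|m1 m1s m1_max] := IHs m'; first exact: mem_head.
  have [le_m|lt_m] := leqP (weight m) (weight m1).
    exists m1 => [|m2]; rewrite inE; first by rewrite m1s orbT.
    by case/predU1P => [->|/m1_max].
  exists m => [|m2]; first exact: mem_head.
  rewrite inE => /predU1P [-> //|/m1_max le_m2].
  exact: leq_trans le_m2 (ltnW lt_m).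
have term_size m : (size (nagata_scalar f@_m * mmap1 nagata_var m)%R
                    <= (weight m).+1)%N.
  have [_ <-] := nagata_monomial m D_gt0.
  by rewrite mul_polyC size_scale_leq.
have coef_m0 : (nagata f)`_(weight m0) = (f@_m0)%:MP.
  rewrite /nagata /mmap coef_sum (bigD1_seq m0) ?msupp_uniq //= big_seq_cond big1 ?addr0.
    have [m_monic m_size] := nagata_monomial m0 D_gt0.
    move/monicP: m_monic; rewrite /lead_coef m_size /= => coef1.
    by rewrite coefCM coef1 mulr1.
  move=> m /andP [mf m_neq]; apply: nth_default; apply: leq_trans (term_size m) _.
  rewrite ltn_neqAle m0_max // andbT; apply: contraNneq m_neq => eq_w.
  apply/eqP/mnmP; apply: (@base_expansion_inj _ D) => // i; exact: ltD.
have size_f : (size (nagata f) <= (weight m0).+1)%N.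
  apply: leq_trans (size_sum _ _ _) _; apply/bigmax_leqP_seq => m mf _.
  by apply: leq_trans (term_size m) _; rewrite ltnS m0_max.
have fm0 : f@_m0 != 0 by rewrite -mcoeff_msupp.
pose h : {poly A} := ((f@_m0)^-1%:MP)%:P.
exists (h * nagata f); last by exists h.
have coef1 : (h * nagata f)`_(weight m0) = 1.
  by rewrite coefCM coef_m0 -mpolyCM mulVf.
have size1 : size (h * nagata f) = (weight m0).+1.
  apply/eqP; rewrite eqn_leq; apply/andP; split.
    by rewrite mul_polyC; apply: leq_trans (size_scale_leq _ _) size_f.
  rewrite ltnNge; apply/negP => /(nth_default 0); rewrite coef1 => /eqP.
  by rewrite oner_eq0.
by rewrite monicE /lead_coef size1 coef1.
Qed.

End Nagata.

(** The ideal lives in an arbitrary [F]-algebra [B] with chosen elements [b], so the induction on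
    [n] can change [b] while keeping [I]. If the contraction of [I] contains a nonzero [f], Nagata's
    substitution makes a multiple of it monic in the last variable and [extend_point] applies;
    otherwise any point will do. *)
Theorem weak_nullstellensatz (F : closedFieldType) n (B : comNzRingType)
    (al : {rmorphism F -> B}) (I : B -> Prop) (b : 'I_n -> B) :
  (forall u v, I u -> I v -> I (u + v)) -> (forall a u, I u -> I (a * u)) ->
  ~ I 1 ->
  exists a : 'I_n -> F, forall f : {mpoly F[n]}, I (mmap al b f) -> f.@[a] = 0.
Proof.
move=> I_add I_mul I_proper; elim: n b => [|n IHn] b.
  exists (fun=> 0) => f; have fC : f = (f@_0)%:MP.
    by apply/mpolyP => m; rewrite mcoeffC (_ : m = 0%MM) ?eqxx ?mulr1 //;
       apply/mnmP => -[].
  rewrite fC mmapC mevalC => If; apply/eqP/negPn/negP => cN0; apply: I_proper.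
  by rewrite -(rmorph1 al) -(mulVf cN0) rmorphM; exact: I_mul.
have [[f [fN0 If]]|allf0] := classic (exists f : {mpoly F[n.+1]},
    f != 0 /\ I (mmap al b f)); last first.
  exists (fun=> 0) => f If; suff -> : f = 0 by rewrite meval0.
  by apply/eqP/negPn/negP => fN0; apply: allf0; exists f.
(* [D] exceeds every exponent of [f]. The elements [b'] undo the change of variables, so that
   [nagata D p] evaluated at [b'] and [y] is [p] evaluated at [b]. *)
pose D := (msize f).+1; pose y := b ord0.
pose b' j := b (lift ord0 j) - y ^+ (D ^ j.+1).
have [a' a'P] := IHn b'.
pose ev : {rmorphism {mpoly F[n]} -> B} := mmap al b'.
pose phi : {rmorphism {mpoly F[n]} -> F} := meval a'.
have nagata_ev p : (map_poly ev (nagata D p)).[y] = mmap al b p.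
  rewrite -[LHS]/((horner_eval y \o map_poly ev) (nagata D p)) rmorph_mmap.
  rewrite /mmap; apply: eq_bigr => m _ /=; congr (_ * _).
    by rewrite map_polyC /horner_eval hornerC /= mmapC.
  apply: eq_bigr => i _ /=; congr (_ ^+ _); rewrite /nagata_var.
  case: unliftP => [j ->|->]; last by rewrite map_polyX /horner_eval hornerX.
  rewrite rmorphD /= map_polyC map_polyXn /horner_eval !hornerE /= mmapX mmap1U.
  by rewrite subrK.
have [|g g_monic [h gE]] := @nagata_regular F n D f fN0.
  move=> m i mf; rewrite ltnS ltnW //; apply: leq_ltn_trans (msize_mdeg_lt mf).
  by rewrite mdegE (bigD1 i) //= leq_addr.
have Ig : I (map_poly ev g).[y].
  by rewrite gE rmorphM hornerM nagata_ev; exact: I_mul.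
have phiC x : phi (mpolyC n x) = x by apply: mevalC.
have [y0 y0P] := extend_point phiC I_add I_mul I_proper g_monic Ig a'P.
(* The point [(a', y0)] is carried back to the original coordinates. *)
exists (fun i => if unlift ord0 i is Some j then a' j + y0 ^+ (D ^ j.+1) else y0).
move=> p Ip; rewrite -(y0P (nagata D p)) ?nagata_ev //.
rewrite -[RHS]/((horner_eval y0 \o map_poly phi) (nagata D p)) rmorph_mmap.
rewrite /meval /mmap; apply: eq_bigr => m _ /=; congr (_ * _).
  by rewrite map_polyC /horner_eval hornerC /= mevalC.
apply: eq_bigr => i _ /=; congr (_ ^+ _); rewrite /nagata_var.
case: unliftP => [j _|_]; last by rewrite map_polyX /horner_eval hornerX.
by rewrite rmorphD /= map_polyC map_polyXn /horner_eval !hornerE /= mevalXU.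
Qed.

(** * Systems of quadratic forms *)

Section Span.
Variables (F : fieldType) (U : lmodType F).
Implicit Types (s : seq U) (x y e : U).

(** A predicate rather than a subspace of a [vectType]: [U] will be a polynomial ring, or [k] over
    [F], of possibly infinite dimension. *)
Inductive span_seq s : U -> Prop :=
| span_seq0 : span_seq s 0
| span_seqZD c e x : e \in s -> span_seq s x -> span_seq s (c *: e + x).

Lemma span_seqD s x y : span_seq s x -> span_seq s y -> span_seq s (x + y).
Proof.
by move=> sx sy; elim: sx => [|c e z es _ IH]; rewrite ?add0r // -addrA; constructor.
Qed.

Lemma span_seqZ s c x : span_seq s x -> span_seq s (c *: x).
Proof.
elim=> [|d e z es _ IH]; first by rewrite scaler0; constructor.
by rewrite scalerDr scalerA; constructor.
Qed.

Lemma span_seq_mem s e : e \in s -> span_seq s e.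
Proof. by move=> es; rewrite -[e]addr0 -{1}[e]scale1r; do 2?constructor. Qed.

Lemma span_seq_sum s (T : eqType) (r : seq T) (E : T -> U) :
  (forall t, t \in r -> span_seq s (E t)) -> span_seq s (\sum_(t <- r) E t).
Proof.
elim: r => [|t r IHr] sE; first by rewrite big_nil; constructor.
rewrite big_cons; apply: span_seqD; first by apply: sE; exact: mem_head.
by apply: IHr => t' t'r; apply: sE; rewrite inE t'r orbT.
Qed.

Lemma span_seq_trans s s' x :
  {in s, forall e, span_seq s' e} -> span_seq s x -> span_seq s' x.
Proof.
move=> ss'; elim=> [|c e z es _ IH]; first by constructor.
by apply: span_seqD => //; apply: span_seqZ; exact: ss'.
Qed.

Lemma span_seq_coord s x : span_seq s x ->
  exists c : 'I_(size s) -> F, x = \sum_(i < size s) c i *: s`_i.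
Proof.
elim=> [|d e z es _ [c ->]].
  by exists (fun=> 0); rewrite big1 // => i _; rewrite scale0r.
have es' : (index e s < size s)%N by rewrite index_mem.
exists (fun i => (if i == Ordinal es' then d else 0) + c i).
rewrite (eq_bigr _ (fun i _ => scalerDl _ _ _)) big_split /=; congr (_ + _).
rewrite (bigD1 (Ordinal es')) //= eqxx nth_index // big1 ?addr0 //.
by move=> i /negbTE ->; rewrite scale0r.
Qed.

(** The coordinate matrix has more rows than columns, hence a nonzero vector in its left kernel. *)
Lemma span_seq_dependent s (p : nat) (e : 'I_p -> U) :
  (forall i, span_seq s (e i)) -> (size s < p)%N ->
  exists c : 'I_p -> F, (exists i, c i != 0) /\ \sum_i c i *: e i = 0.
Proof.
move=> se lt_s.
have [C CE] := fin_all_exists (fun i => span_seq_coord (se i)).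
pose A : 'M[F]_(p, size s) := \matrix_(i, j) C i j.
have ker_neq0 : kermx A != 0.
  rewrite -mxrank_eq0 mxrank_ker -lt0n subn_gt0.
  exact: leq_ltn_trans (rank_leq_col A) lt_s.
have /rowV0Pn [v /sub_kermxP vA vN0] := ker_neq0.
exists (v 0); split.
  have /existsP [i vi] : [exists i, v 0 i != 0].
    apply: contraNT vN0; rewrite negb_exists => /forallP v0.
    by apply/eqP/rowP => i; rewrite mxE; apply/eqP/negPn/v0.
  by exists i.
under eq_bigr => i _ do rewrite CE scaler_sumr.
rewrite exchange_big big1 // => j _.
under eq_bigr => i _ do rewrite scalerA.
rewrite -scaler_suml; have := congr1 (fun X : 'rV_(size s) => X 0 j) vA.
rewrite !mxE => vAj; suff -> : \sum_i v 0 i * C i j = 0 by rewrite scale0r.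
rewrite -[RHS]vAj.
by apply: eq_bigr => i _; rewrite mxE.
Qed.

(** A subsequence of least length with the same span is free, since a nontrivial relation would
    allow one entry to be dropped. *)
Lemma independent_spanning_seq s : exists s',
  [/\ {subset s' <= s}, forall x, span_seq s x -> span_seq s' x &
      forall c : 'I_(size s') -> F, \sum_i c i *: s'`_i = 0 -> forall i, c i = 0].
Proof.
have [|n [s' [s's ss' sz]] n_min] := ex_least_nat (P := fun n => exists s' : seq U,
    [/\ {subset s' <= s}, forall x, span_seq s x -> span_seq s' x & size s' = n]).
  by exists (size s), s; split.
exists s'; rewrite -{n}sz in n_min; split=> // c c0 i; apply/eqP/negPn/negP => ci.
pose s'' := take i s' ++ drop i.+1 s'.
suff : (size s' <= size s'')%N.
  rewrite leqNgt size_cat size_take size_drop ltn_ord; have := ltn_ord i; lia.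
have s''s' : {subset s'' <= s'}.
  by move=> x; rewrite mem_cat => /orP [/mem_take|/mem_drop].
have nth_s'' (j : 'I_(size s')) : j != i -> s'`_j \in s''.
  move=> ji; rewrite mem_cat; apply/orP.
  have [lt_ji|lt_ij|/val_inj eq_ji] := ltngtP j i.
  - left; rewrite -(nth_take 0 lt_ji) mem_nth // size_take.
    by case: ifP => // _; exact: ltn_ord.
  - right; rewrite -(subnKC lt_ij) -nth_drop mem_nth // size_drop.
    by apply: ltn_sub2r => //; exact: leq_ltn_trans lt_ij (ltn_ord j).
  - by rewrite eq_ji eqxx in ji.
apply: n_min; exists s''; split=> // [x /s''s' /s's //|x /ss'].
apply: span_seq_trans => e es'.
have le_e : (index e s' < size s')%N by rewrite index_mem.
have [ei|] := eqVneq (Ordinal le_e) i; last first.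
  by move/nth_s''; rewrite nth_index //; exact: span_seq_mem.
have eE : e = s'`_i by rewrite -ei nth_index.
move: c0; rewrite (bigD1 i) //= -eE => /(congr1 (fun x => (c i)^-1 *: x)).
rewrite scaler0 scalerDr scalerA mulVf // scale1r => /eqP; rewrite addr_eq0 => /eqP ->.
rewrite -scaleN1r; apply: span_seqZ; apply: span_seqZ.
rewrite -big_filter; apply: span_seq_sum => j.
by rewrite mem_filter => /andP [/nth_s'' js _]; apply: span_seqZ; exact: span_seq_mem.
Qed.

End Span.

(** * Common zeros of fewer quadrics than variables *)

Lemma expfM_div (K : fieldType) (a b : K) e : b != 0 -> a ^+ e = b ^+ e * (a / b) ^+ e.
Proof. by move=> bN0; rewrite -exprMn mulrCA divff // mulr1. Qed.

Lemma mulf_div_expr2 (K : fieldType) (b q h : K) e : b != 0 ->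
  b ^+ e.+2 * (q / b ^+ 2 * h) = q * (b ^+ e * h).
Proof.
by move=> bN0; rewrite -addn2 exprD; field.
Qed.

Section Quadrics.
Variables (F : closedFieldType) (N M : nat) (c : 'I_M -> 'I_N -> 'I_N -> F).

Definition quadric_val j (x : 'I_N -> F) : F :=
  \sum_a \sum_b c j a b * x a * x b.

Definition quadric j : {mpoly F[N]} :=
  \sum_a \sum_b (c j a b)%:MP * ('X_a * 'X_b).

Lemma mmap_quadric (S : comNzRingType) (al : {rmorphism F -> S}) (h : 'I_N -> S) j :
  mmap al h (quadric j) = \sum_a \sum_b al (c j a b) * (h a * h b).
Proof.
rewrite rmorph_sum; apply: eq_bigr => a _; rewrite rmorph_sum; apply: eq_bigr => b _.
by rewrite !rmorphM /= mmapC !mmapX !mmap1U.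
Qed.

Lemma meval_quadric j x : (quadric j).@[x] = quadric_val j x.
Proof.
rewrite /meval (mmap_quadric idfun); apply: eq_bigr => a _; apply: eq_bigr => b _.
exact: mulrA.
Qed.

(** The polynomial [X_i^R g(X_1/X_i, ..., X_N/X_i)], for [g] of degree at most [R]; the homogenising
    variable already occurs among the variables of [g]. *)
Definition homogenization i R (g : {mpoly F[N]}) : {mpoly F[N]} :=
  \sum_(m <- msupp g) g@_m *: 'X_[m + U_(i) *+ (R - mdeg m)].

Lemma msize_homogenization i R g : (msize g <= R.+1)%N ->
  (msize (homogenization i R g) <= R.+1)%N.
Proof.
move=> gR; apply: leq_trans (msize_sum _ _ _) _; apply/bigmax_leqP_seq => m mg _.
apply: leq_trans (msizeZ_le _ _) _; rewrite msizeX mdegD mdegMn mdeg1 mul1n ltnS.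
have := leq_trans (msize_mdeg_lt mg) gR; lia.
Qed.

Let K := {fraction {mpoly F[N]}}.
Let toK : {rmorphism {mpoly F[N]} -> K} := @tofrac _.

Lemma homogenizationE i R g : (msize g <= R.+1)%N ->
  toK (homogenization i R g) =
  toK 'X_i ^+ R * mmap (toK \o @mpolyC N F) (fun l => toK 'X_l / toK 'X_i) g.
Proof.
move=> gR; have XN0 : toK 'X_i != 0.
  by rewrite tofrac_eq0 -msize_poly_eq0 msizeX.
rewrite /homogenization rmorph_sum /mmap big_distrr /=.
apply: eq_big_seq => m mg; rewrite -mul_mpolyC rmorphM mulrCA; congr (_ * _).
have mR : (mdeg m <= R)%N by rewrite -ltnS; exact: leq_trans (msize_mdeg_lt mg) gR.
rewrite mpolyXD mpolyXE_id -mpolyXn rmorphM rmorphXn rmorph_prod /= -{2}(subnKC mR).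
rewrite exprD mulrC -mulrA mulrCA; congr (_ * _).
rewrite /mmap1 mdegE -prodrXr -big_split /=; apply: eq_bigr => l _.
by rewrite rmorphXn; exact: expfM_div.
Qed.

(** The Nullstellensatz is applied to the ideal generated by the quadrics and [X_i - 1]. If it
    contains 1, substituting [X_l / X_i] for [X_l] kills [X_i - 1], and multiplying by [X_i^(R+2)]
    clears denominators: 2 for each quadric and [R] for its cofactor. *)
Lemma quadrics_chart i :
  (exists x : 'I_N -> F, x i = 1 /\ forall j, quadric_val j x = 0) \/
  exists R (g : 'I_M -> {mpoly F[N]}), (forall j, (msize (g j) <= R.+1)%N) /\
    'X_i ^+ R.+2 = \sum_j quadric j * g j.
Proof.
pose I (p : {mpoly F[N]}) := exists (g : 'I_M -> {mpoly F[N]}) h,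
  p = \sum_j quadric j * g j + h * ('X_i - 1).
have [[g [h gh1]]|I_proper] := classic (I 1); [right | left]; last first.
  have [u v [g [h ->]] [g' [h' ->]]|a u [g [h ->]]||x xP] :=
      @weak_nullstellensatz F N _ (@mpolyC N F) I (fun l => 'X_l).
  - exists (fun j => g j + g' j), (h + h'); rewrite mulrDl addrACA -big_split /=.
    by congr (_ + _); apply: eq_bigr => j _; rewrite mulrDr.
  - exists (fun j => a * g j), (a * h); rewrite mulrDr mulrA big_distrr /=.
    by congr (_ + _); apply: eq_bigr => j _; rewrite mulrCA.
  - exact: I_proper.
  have mmap_id p : mmap (@mpolyC N F) (fun l => 'X_l) p = p.
    rewrite /mmap [RHS]mpolyE; apply: eq_bigr => m _.
    by rewrite mmap1_id mul_mpolyC.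
  exists x; split=> [|j].
    have := xP ('X_i - 1); rewrite mmap_id mevalB meval1 mevalXU => xi.
    apply/eqP; rewrite -subr_eq0; apply/eqP/xi.
    by exists (fun=> 0), 1; rewrite big1 ?add0r ?mul1r // => j _; rewrite mulr0.
  rewrite -meval_quadric; apply: xP; rewrite mmap_id.
  exists (fun l => (l == j)%:R), 0; rewrite mul0r addr0 (bigD1 j) //= eqxx mulr1.
  by rewrite big1 ?addr0 // => l /negbTE ->; rewrite mulr0.
pose R := (\max_j msize (g j))%N.
have gR j : (msize (g j) <= R.+1)%N by apply: leqW; exact: leq_bigmax.
exists R, (fun j => homogenization i R (g j)); split=> [j|].
  exact: msize_homogenization.
have XN0 : toK 'X_i != 0 by rewrite tofrac_eq0 -msize_poly_eq0 msizeX.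
apply/eqP; rewrite -tofrac_eq; apply/eqP; rewrite -!/(toK _).
rewrite rmorphXn rmorph_sum /=.
pose psi : {rmorphism {mpoly F[N]} -> K} :=
  mmap (toK \o @mpolyC N F) (fun l => toK 'X_l / toK 'X_i).
have psi_quadric j : psi (quadric j) = toK (quadric j) / toK 'X_i ^+ 2.
  rewrite /psi /= mmap_quadric rmorph_sum big_distrl; apply: eq_bigr => a _ /=.
  rewrite rmorph_sum big_distrl; apply: eq_bigr => b _ /=.
  by rewrite !rmorphM /= -!mulrA expr2 invfM; congr (_ * (_ * _)); rewrite mulrCA.
have := congr1 psi gh1; rewrite rmorph1 rmorphD rmorphM rmorphB rmorph1.
rewrite [psi 'X_i]mmapX mmap1U divff // subrr mulr0 addr0 rmorph_sum => /= sum1.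
rewrite -[LHS]mulr1 sum1 big_distrr; apply: eq_bigr => j _ /=.
rewrite [RHS]rmorphM /= homogenizationE // rmorphM psi_quadric -/psi.
exact: mulf_div_expr2.
Qed.

(** Only the exponents of the [M] quadrics depend on [D]; with [r] fixed the length grows like
    [D^M]. *)
Definition quadric_family D r : seq {mpoly F[N]} :=
  [seq \prod_j quadric j ^+ al j * 'X_[[multinom be i | i < N]] |
    al : 'I_D.+1 ^ M <- enum {: 'I_D.+1 ^ M}, be : 'I_r ^ N <- enum {: 'I_r ^ N}].

Lemma size_quadric_family D r : size (quadric_family D r) = (D.+1 ^ M * r ^ N)%N.
Proof. by rewrite size_allpairs -!cardE !card_ffun !card_ord. Qed.

Lemma mem_quadric_family D r (al : 'I_M -> nat) (m : 'X_{1..N}) :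
  (forall j, (al j <= D)%N) -> (forall i, (m i < r)%N) ->
  \prod_j quadric j ^+ al j * 'X_[m] \in quadric_family D r.
Proof.
move=> alD mr; apply/allpairsP.
exists ([ffun j => Ordinal (alD j : (al j < D.+1)%N)], [ffun i => Ordinal (mr i)]).
rewrite !mem_enum /=; split=> //; congr (_ * _).
  by apply: eq_bigr => j _; rewrite ffunE.
by congr 'X_[_]; apply/mnmP => i; rewrite mnmE ffunE.
Qed.

Lemma span_quadricM D r j p : span_seq (quadric_family D r) p ->
  span_seq (quadric_family D.+1 r) (quadric j * p).
Proof.
elim=> [|a e x /allpairsP [[al be] [_ _ /= ->]] _ IH]; first by rewrite mulr0; constructor.
rewrite mulrDr -scalerAr mulrA.
have -> : quadric j * \prod_l quadric l ^+ al l =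
          \prod_l quadric l ^+ ((l == j) + al l)%N.
  rewrite (bigD1 j) //= [RHS](bigD1 j) //= eqxx exprS mulrA; congr (_ * _).
  by apply: eq_bigr => l /negbTE ->.
constructor=> //; apply: mem_quadric_family => [l|i].
  by apply: (@leq_add _ _ 1 D); [case: eqP | rewrite -ltnS ltn_ord].
by rewrite mnmE.
Qed.

(** Induction on the degree. A monomial with all exponents below [R i + 2] is in the family;
    otherwise a factor [X_i^(R i + 2)] is replaced by the combination of quadrics, whose cofactors
    have degree at most [R i], so that the degree drops. *)
Lemma span_quadric_family (R : 'I_N -> nat) (g : 'I_N -> 'I_M -> {mpoly F[N]}) r D p :
  (forall i j, (msize (g i j) <= (R i).+1)%N) ->
  (forall i, 'X_i ^+ (R i).+2 = \sum_j quadric j * g i j) ->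
  (forall i, ((R i).+2 <= r)%N) ->
  (msize p <= D.+1)%N -> span_seq (quadric_family D r) p.
Proof.
move=> gR XE Rr; elim: D p => [|D IHD] p pD; rewrite [p]mpolyE;
  apply: span_seq_sum => m mp; apply: span_seqZ;
  have mD := leq_trans (msize_mdeg_lt mp) pD; rewrite ltnS in mD.
all: have [/forallP mR|/forallPn [i]] := boolP [forall i, (m i < (R i).+2)%N].
1,3: apply: span_seq_mem; have := @mem_quadric_family _ r (fun=> 0%N) m;
  rewrite big1 ?mul1r; [apply=> // i; exact: leq_trans (mR i) (Rr i) | by []].
all: rewrite -leqNgt => le_i.
all: have le_im : (m i <= mdeg m)%N by rewrite mdegE (bigD1 i) //= leq_addr.
  by have := leq_trans le_i (leq_trans le_im mD).
have mE : m = (U_(i) *+ (R i).+2 + (m - U_(i) *+ (R i).+2))%MM.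
  by rewrite addmC submK //; apply/mnm_lepP => l; rewrite mulmnE mnm1E; case: eqP => [<-|_];
     rewrite ?mul1n ?mul0n.
set m' := (m - _)%MM in mE.
have deg_m' : mdeg m = ((R i).+2 + mdeg m')%N.
  by rewrite {1}mE mdegD mdegMn mdeg1 mul1n.
rewrite mE mpolyXD -mpolyXn XE mulr_suml; apply: span_seq_sum => j _.
rewrite -mulrA; apply: span_quadricM; apply: IHD.
rewrite [g i j]mpolyE mulr_suml; apply: leq_trans (msize_sum _ _ _) _.
apply/bigmax_leqP_seq => m'' m''g _.
rewrite -scalerAl -mpolyXD; apply: leq_trans (msizeZ_le _ _) _.
rewrite msizeX mdegD ltnS; have := leq_trans (msize_mdeg_lt m''g) (gR i j).
by move: mD; rewrite deg_m'; lia.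
Qed.

Theorem quadrics_common_zero : (M < N)%N ->
  exists x : 'I_N -> F, (exists i, x i != 0) /\ forall j, quadric_val j x = 0.
Proof.
move=> ltMN; apply: NNPP => nozero.
have charts i : exists Rg : nat * ('I_M -> {mpoly F[N]}),
    (forall j, (msize (Rg.2 j) <= Rg.1.+1)%N) /\
    'X_i ^+ Rg.1.+2 = \sum_j quadric j * Rg.2 j.
  have [[x [xi x0]]|[R [g [gR gE]]]] := quadrics_chart i; last by exists (R, g).
  by case: nozero; exists x; split=> //; exists i; rewrite xi oner_neq0.
have [Rg RgP] := fin_all_exists charts.
pose r := (\max_i (Rg i).1).+2.
(* The [E^N] monomials with exponents below [E] have degree at most [N E], so they lie in the span
   of [(N E + 1)^M r^N] products. This number is at most [E^M (N+1)^M r^N], which is less than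
   [E^(M+1)] by the choice of [E], hence less than [E^N]. *)
pose E := ((N.+1) ^ M * r ^ N).+1.
pose mon (f : 'I_E ^ N) : 'X_{1..N} := [multinom f i | i < N].
pose e (i : 'I_#|{: 'I_E ^ N}|) : {mpoly F[N]} := 'X_[mon (enum_val i)].
have [i||a [[i ai] /(congr1 (mcoeff (mon (enum_val i))))]] :=
    @span_seq_dependent F _ (quadric_family (N * E) r) _ e.
- apply: (@span_quadric_family (fun i => (Rg i).1) (fun i => (Rg i).2)).
  + by move=> l; case: (RgP l).
  + by move=> l; case: (RgP l).
  + by move=> l; rewrite !ltnS; apply: (@leq_bigmax _ (fun i => (Rg i).1)).
  rewrite msizeX ltnS mdegE -[X in (X * _)%N]card_ord -sum_nat_const.
  by apply: leq_sum => l _; rewrite mnmE ltnW.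
- rewrite size_quadric_family card_ffun !card_ord.
  apply: (@leq_trans (E ^ M.+1)%N); last exact: leq_pexp2l.
  apply: (@leq_ltn_trans ((N.+1 * E) ^ M * r ^ N)%N).
    rewrite leq_mul2r; apply/orP; right; case: (M) => // M'.
    by rewrite leq_exp2r // mulSn -add1n leq_add2r.
  by rewrite expnMn mulnAC expnS ltn_mul2r expn_gt0 /E ltnSn.
(* Distinct monomials are independent: reading the coefficient of the monomial of index [i] gives
   [a i = 0]. *)
rewrite mcoeff0 raddf_sum (bigD1 i) //= mcoeffZ mcoeffX eqxx mulr1 big1 ?addr0.
  by move/eqP; rewrite (negbTE ai).
move=> l li; rewrite mcoeffZ mcoeffX; case: eqP => [eq_mon|]; last by rewrite mulr0.
case/eqP: li; apply: enum_val_inj; apply/ffunP => t; apply: val_inj.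
by have := congr1 (fun m : 'X_{1..N} => m t) eq_mon; rewrite !mnmE.
Qed.

End Quadrics.

Lemma quadrics_common_zero_fin (F : closedFieldType) (T : finType) M
    (c : 'I_M -> T -> T -> F) : (M < #|T|)%N ->
  exists x : T -> F, (exists a, x a != 0) /\
    forall j, \sum_a \sum_b c j a b * x a * x b = 0.
Proof.
move=> ltMT.
have [x [[i xi] x0]] :=
  quadrics_common_zero (fun j a b => c j (enum_val a) (enum_val b)) ltMT.
exists (x \o enum_rank); split; first by exists (enum_val i); rewrite /= enum_valK.
move=> j; rewrite -[RHS](x0 j) /quadric_val (reindex _ (onW_bij _ (@enum_val_bij T))).
apply: eq_bigr => a _; rewrite (reindex _ (onW_bij _ (@enum_val_bij T))).
by apply: eq_bigr => b _; rewrite /= !enum_valK.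
Qed.

(** * Linear growth in transcendence degree one *)

(** A copy of [k] that records [iota], so that the scalar multiplication through [iota] can be a
    canonical structure. *)
Definition over_base (F k : fieldType) (iota : {rmorphism F -> k}) : Type := k.

Section OverBase.
Variables (F k : fieldType) (iota : {rmorphism F -> k}).

HB.instance Definition _ := GRing.Field.copy (over_base iota) k.

Definition scale_base (c : F) (x : over_base iota) : over_base iota := iota c * (x : k).

Fact scale_baseA a b x : scale_base a (scale_base b x) = scale_base (a * b) x.
Proof. by rewrite /scale_base rmorphM mulrA. Qed.
Fact scale_base1 : left_id 1 scale_base.
Proof. by move=> x; rewrite /scale_base rmorph1 mul1r. Qed.
Fact scale_baseDr : right_distributive scale_base +%R.
Proof. by move=> a x y; rewrite /scale_base mulrDr. Qed.
Fact scale_baseDl x : {morph scale_base^~ x : a b / a + b}.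
Proof. by move=> a b; rewrite /scale_base rmorphD mulrDl. Qed.

HB.instance Definition _ := GRing.Zmodule_isLmodule.Build F (over_base iota)
  scale_baseA scale_base1 scale_baseDr scale_baseDl.

Lemma scale_baseE (c : F) (x : over_base iota) : c *: x = iota c * (x : k).
Proof. by []. Qed.

End OverBase.

Section Growth.
Variables (F k : fieldType) (iota : {rmorphism F -> k}).
Local Notation kF := (over_base iota).
Implicit Types (x y z t : k) (s e X : seq k).

Definition Fspan s : k -> Prop := @span_seq F kF s.

Lemma Fspan_bind s s' x y : {in s, forall z, Fspan s' (x * z)} ->
  Fspan s y -> Fspan s' (x * y).
Proof.
move=> ss'; rewrite /Fspan; elim=> [|c z w zs _ IH]; first by rewrite mulr0; constructor.
rewrite scale_baseE mulrDr mulrCA -scale_baseE.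
by apply: span_seqD => //; apply: span_seqZ; apply: ss'.
Qed.

Lemma Fspan_coord s x : Fspan s x ->
  exists c : 'I_(size s) -> F, x = \sum_i iota (c i) * s`_i.
Proof. exact: span_seq_coord. Qed.

Definition Ffree s : Prop := forall c : 'I_(size s) -> F,
  \sum_i iota (c i) * s`_i = 0 -> forall i, c i = 0.

Lemma Fspan_basis s : exists s',
  [/\ {subset s' <= s}, forall x, Fspan s x -> Fspan s' x & Ffree s'].
Proof. exact: (@independent_spanning_seq F kF s). Qed.

Lemma Ffree_leq_size s s' : Ffree s -> {in s, forall x, Fspan s' x} ->
  (size s <= size s')%N.
Proof.
move=> s_free ss'; rewrite leqNgt; apply/negP => lt_s'.
have [i|c [[i ci] c0]] :=
    @span_seq_dependent F kF s' (size s) (fun i => s`_i) _ lt_s'.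
  by apply: ss'; exact: mem_nth.
by rewrite (s_free c c0) eqxx in ci.
Qed.

(** Generators of the [F]-space V_m. *)
Fixpoint words X m : seq k :=
  if m is m'.+1 then [seq x * w | x <- X, w <- words X m'] else [:: 1].

Lemma words_mul X m n w w' : w \in words X m -> w' \in words X n ->
  w * w' \in words X (m + n).
Proof.
move=> + w'n; elim: m w => [|m IHm] w /=; first by rewrite inE => /eqP ->; rewrite mul1r.
case/allpairsP => -[x v] /= [xX vm ->]; rewrite -mulrA.
by apply: allpairs_f => //; exact: IHm.
Qed.

Lemma words_morph X (sigma : {rmorphism k -> k}) m w :
  {in X, forall x, sigma x \in X} -> w \in words X m -> sigma w \in words X m.
Proof.
move=> sX; elim: m w => [|m IHm] w /=; first by rewrite inE => /eqP ->; rewrite rmorph1 mem_head.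
case/allpairsP => -[x v] /= [xX vm ->]; rewrite rmorphM.
by apply: allpairs_f; [exact: sX | exact: IHm].
Qed.

(** * Finitely generated modules over [F[t]] *)

Section SimpleExtension.
Variable t : k.

Definition evt (p : {poly F}) : k := (map_poly iota p).[t].

Lemma evtM p q : evt (p * q) = evt p * evt q.
Proof. by rewrite /evt rmorphM hornerM. Qed.

Lemma evt1 : evt 1 = 1.
Proof. by rewrite /evt rmorph1 hornerC. Qed.

(** The [F[t]]-submodule of [k] generated by [e]. Coefficients are polynomials in [t], not
    fractions, so that degrees in [t] can be counted. *)
Inductive Ftmod e : k -> Prop :=
| Ftmod0 : Ftmod e 0
| FtmodZD p b x : b \in e -> Ftmod e x -> Ftmod e (evt p * b + x).

Lemma FtmodD e x y : Ftmod e x -> Ftmod e y -> Ftmod e (x + y).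
Proof.
by move=> ex ey; elim: ex => [|p b z be _ IH]; rewrite ?add0r // -addrA; constructor.
Qed.

Lemma FtmodZ e p x : Ftmod e x -> Ftmod e (evt p * x).
Proof.
elim=> [|q b z be _ IH]; first by rewrite mulr0; constructor.
by rewrite mulrDr mulrA -evtM; constructor.
Qed.

Lemma Ftmod_mem e b : b \in e -> Ftmod e b.
Proof. by move=> be; rewrite -[b]addr0 -{1}[b]mul1r -evt1; do 2?constructor. Qed.

Lemma Ftmod_bind e e' c x : {in e, forall b, Ftmod e' (c * b)} ->
  Ftmod e x -> Ftmod e' (c * x).
Proof.
move=> ee'; elim=> [|p b z be _ IH]; first by rewrite mulr0; constructor.
by rewrite mulrDr mulrCA; apply: FtmodD => //; apply: FtmodZ; exact: ee'.
Qed.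

Lemma Ftmod_sum e (T : Type) (r : seq T) (E : T -> k) :
  (forall i, Ftmod e (E i)) -> Ftmod e (\sum_(i <- r) E i).
Proof. by move=> eE; elim/big_ind: _ => //; [constructor | exact: FtmodD]. Qed.

Lemma common_denominator n (f : nat -> k) :
  (forall i, in_simple_ext iota t (f i)) ->
  exists2 q, evt q != 0 & forall i, (i < n)%N -> exists p, evt q * f i = evt p.
Proof.
move=> fE; elim: n => [|n [q qN0 qP]]; first by exists 1; rewrite // evt1 oner_neq0.
have [p [q' fn]] := fE n; rewrite -/(evt p) -/(evt q') in fn.
(* If the denominator vanishes at [t], then [f n] is 0 by convention and the previous [q] still
   works. *)
have [q'0|q'N0] := eqVneq (evt q') 0.
  exists q => // i; rewrite ltnS leq_eqVlt => /predU1P [->|]; last exact: qP.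
  by exists 0; rewrite fn q'0 invr0 !mulr0 /evt rmorph0 horner0.
exists (q' * q) => [|i]; first by rewrite evtM mulf_neq0.
rewrite ltnS leq_eqVlt => /predU1P [->|/qP [p' p'E]].
  by exists (q * p); rewrite fn !evtM mulrAC [evt p / _]mulrC mulrA mulfV // mul1r mulrC.
by exists (q' * p'); rewrite !evtM -mulrA p'E.
Qed.

(** A common denominator moves the coefficients into [F[t]]; the top one stays nonzero but need not
    be 1. The degree is at least 1 because the polynomial is nonzero and has a root. *)
Lemma algebraic_equation x : algebraic_over_simple_ext iota t x ->
  exists d (a : nat -> {poly F}), evt (a d.+1) != 0 /\
    evt (a d.+1) * x ^+ d.+1 = - \sum_(l < d.+1) evt (a l) * x ^+ l.
Proof.
case=> P [PN0 Pt rootP].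
have sizeP := root_size_gt1 PN0 rootP.
have [q qN0 qP] := common_denominator (size P) Pt.
have [a aP] := fin_all_exists (fun i : 'I_(size P) => qP i (ltn_ord i)).
have [d sP] : exists d, size P = d.+2 by exists (size P).-2; lia.
pose a' l := if insub l is Some i then a i else 0.
have a'E l : (l < size P)%N -> evt (a' l) = evt q * P`_l.
  by move=> lP; rewrite /a' insubT /= -aP.
exists d, a'; split.
  by rewrite a'E ?sP // mulf_neq0 // -[d.+1]/(d.+2.-1) -sP lead_coef_eq0.
apply/eqP; rewrite -addr_eq0 addrC; apply/eqP.
have -> : \sum_(l < d.+1) evt (a' l) * x ^+ l + evt (a' d.+1) * x ^+ d.+1 =
   \sum_(l < size P) evt (a' l) * x ^+ l by rewrite sP [RHS]big_ord_recr.
transitivity (evt q * P.[x]); last by rewrite (eqP rootP) mulr0.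
rewrite horner_coef mulr_sumr; apply: eq_bigr => l _.
by rewrite a'E // mulrA.
Qed.

(** The module is stable under [X] up to one denominator [p]. To adjoin [x] of degree [d + 1], the
    generators are multiplied by the powers of [x] up to [d], and [p] by the leading coefficient of
    the equation of [x]. *)
Lemma finite_over_simple_ext X :
  {in X, forall x, algebraic_over_simple_ext iota t x} ->
  exists e p, [/\ evt p != 0, Ftmod e 1 &
    {in X & e, forall x b, Ftmod e (evt p * (x * b))}].
Proof.
elim: X => [|x X IHX] algX.
  exists [:: 1], 1; rewrite evt1 oner_neq0; split=> //.
  exact/Ftmod_mem/mem_head.
have [|e [p [pN0 e1 eX]]] := IHX.
  by move=> y yX; apply: algX; rewrite inE yX orbT.
have [d [a [aN0 xE]]] := algebraic_equation (algX x (mem_head _ _)).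
pose e' := [seq b * x ^+ l | b <- e, l <- seq.iota 0 d.+1].
have e'_mem b l : b \in e -> (l < d.+1)%N -> b * x ^+ l \in e'.
  by move=> be ld; apply: allpairs_f; rewrite // mem_iota.
have e'_mul l z : (l < d.+1)%N -> Ftmod e z -> Ftmod e' (x ^+ l * z).
  move=> ld; apply: Ftmod_bind => b be; rewrite mulrC.
  exact/Ftmod_mem/e'_mem.
exists e', (p * a d.+1); rewrite evtM mulf_neq0 //; split=> //.
  by have := e'_mul 0%N _ isT e1; rewrite expr0 mul1r.
have e'P c : c \in e' -> exists b l, [/\ b \in e, (l < d.+1)%N & c = b * x ^+ l].
  by case/allpairsP => -[b l] [be ld ->]; exists b, l; rewrite mem_iota in ld.
move=> y c; rewrite inE => /predU1P [->|yX] /e'P [b [l [be ld ->]]].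
  have [lt_ld|ge_ld] := ltnP l.+1 d.+1.
    rewrite [x * _]mulrCA -exprS -evtM; apply: FtmodZ; apply: Ftmod_mem; exact: e'_mem.
  (* At the top power, the leading coefficient in the new denominator allows [x^(d+1)] to be
     rewritten by lower powers. *)
  have -> : l = d by lia.
  rewrite [x * _]mulrCA -exprS -mulrA [evt (a _) * _]mulrCA xE; apply: FtmodZ.
  rewrite mulrN -mulN1r; have -> : -1 = evt (-1).
    by rewrite /evt rmorphN rmorph1 hornerN hornerC.
  apply: FtmodZ; rewrite big_distrr /=; apply: Ftmod_sum => i.
  by rewrite mulrCA; apply: FtmodZ; apply: Ftmod_mem; exact: e'_mem.
have -> : evt p * evt (a d.+1) * (y * (b * x ^+ l)) =
   evt (a d.+1) * (x ^+ l * (evt p * (y * b))) by ring.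
by apply: FtmodZ; apply: e'_mul => //; exact: eX.
Qed.

(** Filtration of the [F[t]]-module generated by [e] by the degree in [t]. *)
Definition tpowers n e : seq k := [seq t ^+ i * b | i <- seq.iota 0 n.+1, b <- e].

Lemma mem_tpowers n e i b : (i <= n)%N -> b \in e -> t ^+ i * b \in tpowers n e.
Proof. by move=> le_in be; apply: allpairs_f; rewrite // mem_iota ltnS. Qed.

Lemma tpowersP n e x : x \in tpowers n e ->
  exists i b, [/\ (i <= n)%N, b \in e & x = t ^+ i * b].
Proof. by case/allpairsP => -[i b] [in_n be ->]; exists i, b; rewrite mem_iota in in_n. Qed.

Lemma tpowersS m n e x : (m <= n)%N -> Fspan (tpowers m e) x -> Fspan (tpowers n e) x.
Proof.
move=> le_mn; apply: span_seq_trans => _ /tpowersP [i [b [im be ->]]].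
by apply: span_seq_mem; apply: mem_tpowers => //; exact: leq_trans le_mn.
Qed.

Lemma Ftmod_tpowers e x : Ftmod e x -> exists n, Fspan (tpowers n e) x.
Proof.
elim=> [|p b z be _ [n IH]]; first by exists 0%N; constructor.
exists (maxn n (size p)); apply: span_seqD; last first.
  by apply: tpowersS IH; exact: leq_maxl.
rewrite /evt (@horner_coef_wide _ (size p)) ?size_poly // mulr_suml.
apply: span_seq_sum => i _; rewrite coef_map -mulrA.
rewrite -[iota _ * _]scale_baseE; apply: span_seqZ; apply: span_seq_mem.
apply: mem_tpowers => //; rewrite leq_max.
by rewrite [(i <= size p)%N]ltnW ?orbT.
Qed.

Lemma tpowers_exp c e i z : Fspan (tpowers c e) z ->
  Fspan (tpowers (i + c) e) (t ^+ i * z).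
Proof.
apply: Fspan_bind => _ /tpowersP [j [b [jc be ->]]].
by apply: span_seq_mem; rewrite mulrA -exprD; apply: mem_tpowers; rewrite ?leq_add2l.
Qed.

(** Multiplication by [p x], for [x] in [X], raises the degree in [t] by at most a constant [c], so
    [p^m] carries V_m into the part of degree at most [c (m+1)]. Dividing by [p^m] keeps the number
    of generators. *)
Lemma words_linear_growth X :
  {in X, forall x, algebraic_over_simple_ext iota t x} ->
  exists C, forall m, exists s, (size s <= C * m.+1)%N /\
    forall z, Fspan (words X m) z -> Fspan s z.
Proof.
move=> /finite_over_simple_ext [e [p [pN0 e1 eX]]].
have [c [c1 cX]] : exists c, Fspan (tpowers c e) 1 /\
    {in X & e, forall x b, Fspan (tpowers c e) (evt p * (x * b))}.
  have [n0 n0P] := Ftmod_tpowers e1.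
  have bound (r : seq (k * k)) : {in r, forall xb, Ftmod e (evt p * (xb.1 * xb.2))} ->
      exists n, {in r, forall xb, Fspan (tpowers n e) (evt p * (xb.1 * xb.2))}.
    elim: r => [|xb r IHr] re; first by exists 0%N.
    have [|n nP] := IHr; first by move=> u ur; apply: re; rewrite inE ur orbT.
    have [n' n'P] := Ftmod_tpowers (re xb (mem_head _ _)).
    exists (maxn n n') => u; rewrite inE => /predU1P [->|/nP].
      by apply: tpowersS n'P; exact: leq_maxr.
    by apply: tpowersS; exact: leq_maxl.
  have [|n nP] := bound [seq (x, b) | x <- X, b <- e].
    by move=> _ /allpairsP [[x b] /= [xX be ->]]; exact: eX.
  exists (maxn n0 n); split; first by apply: tpowersS n0P; exact: leq_maxl.
  move=> x b xX be; have xbP := nP (x, b) (allpairs_f _ xX be).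
  by apply: tpowersS xbP; exact: leq_maxr.
have words_tpowers m w : w \in words X m ->
    Fspan (tpowers (c * m.+1) e) (evt p ^+ m * w).
  elim: m w => [|m IHm] w /=.
    by rewrite inE => /eqP ->; rewrite expr0 mulr1 muln1.
  case/allpairsP => -[x v] /= [xX /IHm vm ->].
  have -> : evt p ^+ m.+1 * (x * v) = evt p * x * (evt p ^+ m * v).
    by rewrite exprS; ring.
  apply: Fspan_bind vm => _ /tpowersP [i [b [im be ->]]].
  have -> : evt p * x * (t ^+ i * b) = t ^+ i * (evt p * (x * b)) by ring.
  apply: (@tpowersS (i + c)); last by apply: tpowers_exp; exact: cX.
  by rewrite [(c * _)%N]mulnS addnC leq_add2l.
(* The degrees 0 to [c (m+1)] give [c (m+1) + 1] powers of [t], at most [(c+1) (m+1)]. *)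
exists (c.+1 * size e)%N => m.
exists [seq (evt p ^+ m)^-1 * z | z <- tpowers (c * m.+1) e]; split.
  rewrite size_map size_allpairs size_iota mulnAC leq_mul2r.
  by apply/orP; right; rewrite [(c.+1 * _)%N]mulSn -add1n leq_add2r.
move=> z; apply: span_seq_trans => w /words_tpowers wP.
have pmN0 : evt p ^+ m != 0 by rewrite expf_neq0.
rewrite -[w](mulKf pmN0); apply: Fspan_bind wP => v v_in.
exact/span_seq_mem/map_f.
Qed.

End SimpleExtension.
End Growth.

(** * Isotropic vectors *)

Section Isotropy.
Variables (F : closedFieldType) (k : fieldType) (iota : {rmorphism F -> k}).
Variables (sigma : {rmorphism k -> k}).
Hypothesis sigma_F : forall c, sigma (iota c) = iota c.
Variable H : 'I_3 -> 'I_3 -> k.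

Definition anisotropic_coef : Prop := forall u : 'I_3 -> k,
  \sum_p \sum_q H p q * (u p * sigma (u q)) = 0 -> forall p, u p = 0.

(** The unknowns are the coordinates over [s] of three elements of V_m, and the coordinates over
    [s'] of the value of the form are quadrics in them. With fewer quadrics than unknowns there is a
    nonzero common zero; anisotropy makes the three elements vanish, against the freeness of [s]. *)
Lemma anisotropic_growth X (m : nat) (s s' : seq k) :
  anisotropic_coef ->
  (forall p q, H p q \in X) -> {in X, forall x, sigma x \in X} ->
  {subset s <= words X m} ->
  Ffree iota s -> (forall z, Fspan iota (words X m.*2.+1) z -> Fspan iota s' z) ->
  (3 * size s <= size s')%N.
Proof.
move=> aniso HX sX sW s_free s'_span; rewrite leqNgt; apply/negP => lt_s'.
pose T := ('I_3 * 'I_(size s))%type.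
pose G (a b : T) : k := H a.1 b.1 * (s`_a.2 * sigma s`_b.2).
have sn (i : 'I_(size s)) : s`_i \in words X m by apply/sW/mem_nth.
have GW a b : Fspan iota s' (G a b).
  apply/s'_span/span_seq_mem; rewrite -addnn -add1n; apply: words_mul.
    by rewrite -[H _ _]mulr1; apply: allpairs_f => //; exact: mem_head.
  by apply: words_mul => //; apply: words_morph.
have [c cE] := fin_all_exists (fun ab : T * T => Fspan_coord (GW ab.1 ab.2)).
have ltT : (size s' < #|{: T}|)%N by rewrite card_prod !card_ord.
have [x [[[p0 i0] xN0] x0]] := quadrics_common_zero_fin (fun j a b => c (a, b) j) ltT.
pose u p : k := \sum_i iota (x (p, i)) * s`_i.
suff u0 : forall p, u p = 0.
  by move: xN0; rewrite (s_free (fun i => x (p0, i)) (u0 p0)) eqxx.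
apply: aniso.
(* Since [sigma] fixes [F], the unknowns come out of [sigma] unchanged and the expression is
   quadratic over [F]. *)
have uE p q : H p q * (u p * sigma (u q)) =
    \sum_i \sum_j iota (x (p, i) * x (q, j)) * G (p, i) (q, j).
  rewrite /u rmorph_sum big_distrlr /= mulr_sumr; apply: eq_bigr => i _.
  rewrite mulr_sumr; apply: eq_bigr => j _.
  rewrite !rmorphM sigma_F /G /=; ring.
have sumT (f : T -> k) : \sum_a f a = \sum_p \sum_i f (p, i).
  by rewrite pair_bigA; apply: eq_bigr => -[].
transitivity (\sum_(a : T) \sum_(b : T) iota (x a * x b) * G a b).
  rewrite sumT; apply: eq_bigr => p _; under eq_bigr => q _ do rewrite uE.
  by rewrite exchange_big; apply: eq_bigr => i _; rewrite sumT.
transitivity (\sum_(j < size s')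
    iota (\sum_a \sum_b c (a, b) j * x a * x b) * s'`_j).
  under [RHS]eq_bigr => j _ do rewrite rmorph_sum mulr_suml.
  rewrite [RHS]exchange_big; apply: eq_bigr => a _.
  under [RHS]eq_bigr => j _ do rewrite rmorph_sum mulr_suml.
  rewrite [RHS]exchange_big; apply: eq_bigr => b _.
  rewrite (cE (a, b)) mulr_sumr; apply: eq_bigr => j _.
  by rewrite !rmorphM /=; ring.
by rewrite big1 // => j _; rewrite x0 rmorph0 mul0r.
Qed.

(** At [j = 2 C] the auxiliary inequality, halved, reads [(C+1) 2^(2C) <= 3^(2C)]. *)
Lemma exp3_gt_exp2 C : (C * 2 ^ C.*2 < 3 ^ C.*2)%N.
Proof.
have aux j : (j.+2 * 2 ^ j <= 2 * 3 ^ j)%N.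
  elim: j => [|j IHj] //; rewrite !expnS; move: IHj; nia.
have := aux C.*2; have : (0 < 2 ^ C.*2)%N by rewrite expn_gt0.
rewrite -addnn; nia.
Qed.

Hypothesis sigmaK : involutive sigma.
Hypothesis trdeg_k : trdeg_one iota.

Lemma sesquilinear_isotropic : exists u : 'I_3 -> k, (exists p, u p != 0) /\
  \sum_p \sum_q H p q * (u p * sigma (u q)) = 0.
Proof.
apply: NNPP => no_zero.
have aniso : anisotropic_coef.
  move=> u u0 p; apply/eqP/negPn/negP => up; apply: no_zero.
  by exists u; split=> //; exists p.
pose X0 := 1 :: [seq H p q | p <- enum 'I_3, q <- enum 'I_3].
pose X := X0 ++ map sigma X0.
have HX p q : H p q \in X.
  by rewrite mem_cat inE; apply/orP; left; apply/orP; right; apply: allpairs_f; rewrite mem_enum.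
have sX : {in X, forall x, sigma x \in X}.
  move=> x; rewrite !mem_cat => /orP [xX|/mapP [y yX ->]].
    by rewrite [X in _ || X]map_f ?orbT.
  by rewrite sigmaK yX.
have [t [_ algt]] := trdeg_k.
have [C CP] := words_linear_growth (X := X) (fun x _ => algt x).
have basis m := Fspan_basis iota (words X m).
(* The lengths [m = 2^j - 1] satisfy [2 m + 1 = 2^(j+1) - 1], so each step of the induction triples
   the lower bound; V_0 has dimension at least 1 as it contains 1. *)
have growth j (s : seq k) : {subset s <= words X (2 ^ j).-1} ->
    (forall z, Fspan iota (words X (2 ^ j).-1) z -> Fspan iota s z) ->
    Ffree iota s -> (3 ^ j <= size s)%N.
  elim: j s => [|j IHj] s sW s_span s_free.
    rewrite lt0n; apply/negP => /nilP s0; have := s_span 1 (span_seq_mem (mem_head _ _)).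
    rewrite s0 => /Fspan_coord [c]; rewrite big_ord0 => /eqP.
    by rewrite oner_eq0.
  have [s1 [s1W s1_span s1_free]] := basis (2 ^ j).-1.
  rewrite expnS; apply: leq_trans (anisotropic_growth aniso HX sX s1W s1_free _).
    by rewrite leq_mul2l IHj.
  have -> : (2 ^ j).-1.*2.+1 = (2 ^ j.+1).-1 by rewrite expnS; have := expn_gt0 2 j; lia.
  exact: s_span.
(* With [m + 1 = 2^j] the linear bound is [C 2^j], below [3^j] for this [j]. *)
pose j := C.*2.
have [s [sW s_span s_free]] := basis (2 ^ j).-1.
have [s' [s'_size s'_span]] := CP (2 ^ j).-1.
have : (size s <= size s')%N.
  by apply: Ffree_leq_size s_free _ => x /sW xW; exact/s'_span/span_seq_mem.
rewrite leqNgt; case/negP; apply: leq_ltn_trans s'_size _.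
apply: leq_trans (growth j s sW s_span s_free).
by rewrite prednK ?expn_gt0 //; exact: exp3_gt_exp2.
Qed.

End Isotropy.

(** * Consequences for hermitian forms and Maschke's theorem *)

Section HermitianForms.
Variables (F : closedFieldType) (k : fieldType) (iota : {rmorphism F -> k}).
Hypothesis trdeg_k : trdeg_one iota.
Variable sigma : involutive_rmorphism k.
Hypothesis sigma_F : forall c : F, sigma (iota c) = iota c.
Variable V : vectType k.

Lemma hermitian_form_isotropic (form : {hermitian_sym V for sigma}) :
  (3 <= \dim {:V})%N -> exists v : V, v <> 0 /\ isotropic form v.
Proof.
move=> dimV.
(* The form is restricted to the span of the first three basis vectors. *)
pose w (p : 'I_3) : V := (vbasis {:V})`_p.
have [u [[p0 up0] u0]] := sesquilinear_isotropic sigma_F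
  (fun p q => form (w p) (w q)) (rmorphK sigma) trdeg_k.
exists (\sum_p u p *: w p); split.
  (* [a] pads [u] with zeros to a coefficient family on the whole basis, so that freeness of the
     basis applies. *)
  move=> v0; move: up0; pose a (i : 'I_(\dim {:V})) :=
    if insub (val i) is Some p then u p else 0.
  have /freeP/(_ a) := basis_free (vbasisP {:V}).
  have -> : \sum_(i < \dim {:V}) a i *: (vbasis {:V})`_i = \sum_p u p *: w p.
    rewrite -(big_mkord xpredT (fun i => (if insub i is Some p then u p else 0) *: (vbasis {:V})`_i)).
    rewrite (big_cat_nat _ dimV) //= big_mkord [X in _ + X]big_nat [X in _ + X]big1 ?addr0.
      by apply: eq_bigr => p _; rewrite valK.
    by move=> i /andP [le_i _]; rewrite insubN ?scale0r // -leqNgt.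
  move=> /(_ v0 (widen_ord dimV p0)) ; rewrite /a /= (valK p0) => ->.
  by rewrite eqxx.
rewrite /isotropic linear_sumlz; rewrite -[RHS]u0; apply: eq_bigr => p _.
rewrite linearZl_LR linear_sumr /= mulr_sumr; apply: eq_bigr => q _.
by rewrite linearZr_LR /= [RHS]mulrCA; congr (_ * _); exact: mulrC.
Qed.

End HermitianForms.

(** The line through [v] is a proper submodule contained in its own orthogonal, so the radical of
    the restricted form is the whole line. *)
Lemma isotropic_not_Maschke (k : fieldType) (sigma : {rmorphism k -> k})
    (gT : finGroupType) (V : vectType k) (to : {action gT &-> V})
    (form : {hermitian_sym V for sigma}) (v : V) :
  trivial_action to -> (1 < \dim {:V})%N -> v <> 0 -> isotropic form v ->
  ~ Maschke_form to form.
Proof.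
move=> to1 dimV v0 v_iso [_ /(_ <[v]>%VS)]; rewrite /nondegenerate_on => nondeg.
have vv : (<[v]> <= orthov form <[v]>)%VS by rewrite orthov11; apply/eqP.
suff /eqP : <[v]>%VS = 0%VS by rewrite -dimv_eq0 dim_vline; move/eqP: v0 => ->.
rewrite -[LHS](capv_idPl vv); apply: nondeg => [w g|vV]; first by rewrite to1.
by move: dimV; rewrite -vV dim_vline; case: (v != 0).
Qed.

Theorem mainTheorem2 (F : closedFieldType) (k : fieldType)
    (iota : {rmorphism F -> k}) (trdeg_k : trdeg_one iota)
    (sigma : involutive_rmorphism k)
    (sigma_F : forall c : F, sigma (iota c) = iota c)
    (sigma_char : (exists x : k, sigma x <> x) \/ 2%N \notin [pchar k])
    (gT : finGroupType) :
  [/\ forall (V : vectType k) (to : {action gT &-> V}),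
        trivial_action to ->
        forall (form : {hermitian_sym V for sigma}) (v : V),
        v <> 0 -> isotropic form v ->
        submodule to <[v]>%VS /\ (<[v]> <= orthov form <[v]>)%VS,
      forall (V : vectType k) (to : {action gT &-> V}),
        trivial_action to -> (3 <= \dim {:V})%N ->
        (forall form : {hermitian_sym V for sigma},
           exists v : V, v <> 0 /\ isotropic form v)
        /\ ~ (exists form : {hermitian_sym V for sigma}, Maschke_form to form)
    & [pchar k]^'.-nat #|gT| -> ~ Maschke_proof_generalizes sigma gT].
Proof.
have dim3 (V : vectType k) (to : {action gT &-> V}) : trivial_action to ->
    (3 <= \dim {:V})%N -> (forall form : {hermitian_sym V for sigma},
       exists v : V, v <> 0 /\ isotropic form v)
    /\ ~ (exists form : {hermitian_sym V for sigma}, Maschke_form to form).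
  move=> to1 dimV; have iso := hermitian_form_isotropic trdeg_k sigma_F.
  split=> [form|[form]]; first exact: iso.
  have [v [v0 v_iso]] := iso _ form dimV.
  exact: isotropic_not_Maschke to1 (ltnW dimV) v0 v_iso.
split=> // [V to to1 form v _ v_iso|_ gen].
  by split=> [w g|]; rewrite ?to1 // orthov11; apply/eqP.
(* The counterexample is [k^3] with the trivial action of [gT]. *)
pose V : vectType k := 'rV[k]_3.
pose to : {action gT &-> V} := TotalAction (to := fun v _ => v)
  (fun=> erefl) (fun _ _ _ => erefl).
have [||_] := dim3 V to; [by [] | by rewrite dimvf dim_matrix | apply].
by apply: gen => g a u v.
Qed.
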